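(* Consider the electricity market model of the context, under Assumptions (A), (B) and the convention (K). For $k\in P\cup C$ let $\tilde{\mathcal Z}_k:\mathbb R^N\setminus\bar S_M\to\mathbb R^N$ be the $\mathbb{PC}^\infty$ mapping sending an expected electricity price vector $E$ to the optimal electricity volume vector $V_k$ of player $k$ at $E$, and let $\tilde{\mathcal Z}=\sum_{k\in P\cup C}\tilde{\mathcal Z}_k$. Let $E$ be any point of $\{x\in\mathbb R^N\setminus\bar S_M: |\mathcal I^e(x)|=1\}$ (where $\mathcal I^e$ refers to $\tilde{\mathcal Z}$), so that the Jacobians $\mathcal D\tilde{\mathcal Z}_k:=\mathcal D\tilde{\mathcal Z}_k(E)$ exist for all $k\in P\cup C$. Then $x^\top\mathcal D\tilde{\mathcal Z}_p\,x\le0$ for all $x\in\mathbb R^N$ and all $p\in P$. Moreover, if for each delivery period $j\in J$ there exists at least one power plant that has a strictly feasible optimal production at $T_j$, then $\sum_{p\in P}\hat A_1\,\mathcal D\tilde{\mathcal Z}_p\,\hat A_1^\top$ has full rank.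
   Context: Model. $P$ (producers) and $C$ (consumers) are finite nonempty sets, $L$ is a finite set of fuels, and $R^{p,l}$ is the finite set of power plants of producer $p$ running on fuel $l$. $T_1,\dots,T_{T'}$ are delivery times, $J=\{1,\dots,T'\}$; for $j\in J$ the finite set $I_j$ indexes the trading times $t_i$ for delivery at $T_j$; $N=\sum_{j\in J}|I_j|$. $\hat r\in\mathbb R$ is an interest rate. $\Pi(t_i,T_j)$ (electricity), $G_l(t_i,T_j)$ (fuel $l$) and $G_{em}(t_i,T_j)$ (emissions) are forward prices: real random variables with finite second moments on a probability space with measure $\mathbb P$. $\Pi\in\mathbb R^N$, $G\in\mathbb R^{N|L|}$, $G_{em}\in\mathbb R^N$ denote the vectors of all these prices, each entry with delivery time $T_j$ multiplied by $e^{-\hat rT_j}$; vectors indexed by $(i,j)$ are ordered in consecutive blocks $j=1,\dots,T'$. $D(T_j)\in\mathbb R$ is the (known) demand, and $p_c\in[0,1]$ with $\sum_{c\in C}p_c=1$. Producer $p$ chooses $v_p=(V_p,F_p,O_p,W_p)$, consisting of real numbers $V_p(t_i,T_j)$, $F_{p,l}(t_i,T_j)$, $O_p(t_i,T_j)$, $W_{p,l,r}(T_j)$ ($j\in J$, $i\in I_j$, $l\in L$, $r\in R^{p,l}$). The feasible set $S_p$ consists of all $v_p$ satisfying the equalities $-\sum_{i\in I_j}V_p(t_i,T_j)=\sum_{l}\sum_{r\in R^{p,l}}W_{p,l,r}(T_j)$ for all $j$; $\sum_{r\in R^{p,l}}c^{p,l,r}W_{p,l,r}(T_j)=\sum_{i\in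 I_j}F_{p,l}(t_i,T_j)$ for all $j,l$; $\sum_j\sum_{i\in I_j}O_p(t_i,T_j)=\sum_j\sum_l\sum_{r\in R^{p,l}}g^lW_{p,l,r}(T_j)$; and the inequalities ramping: $\triangle\overline W_{min}^{p,l,r}\le W_{p,l,r}(T_{j+1})-W_{p,l,r}(T_j)\le\triangle\overline W_{max}^{p,l,r}$ for $j\in\{1,\dots,T'-1\}$; capacity: $0\le W_{p,l,r}(T_j)\le\overline W_{max}^{p,l,r}$; trading bounds: $|F_{p,l}(t_i,T_j)|\le F_{trade}$; $|O_p(t_i,T_j)|\le F_{trade}$; $|V_p(t_i,T_j)|\le V_{trade}$. Here $c^{p,l,r}>0$, $g^l>0$, the ramping bounds and $\overline W_{max}^{p,l,r}$ are given real constants, and $F_{trade},V_{trade}>0$ are given (large) constants. Consumer $c$ chooses $V_c\in\mathbb R^N$ with entries $V_c(t_i,T_j)$; $S_c$ is the set of $V_c$ with $\sum_{i\in I_j}V_c(t_i,T_j)=p_cD(T_j)$ for all $j$ and $|V_c(t_i,T_j)|\le V_{trade}$ for all $i,j$. $E\in\mathbb R^N$ denotes the vector of expected discounted electricity prices (entries $E(t_i,T_j)=e^{-\hat rT_j}\times$ expected value of $\Pi(t_i,T_j)$); choosing $E$ shifts the mean of $\Pi$ but leaves all covariances unchanged. Let $\hat Q$ be the covariance matrix under $\mathbb P$ of $(\Pi,G,G_{em})$ and $\hat Q_1$ that of $\Pi$. With $v_p'=(V_p,F_p,O_p)$ and risk preferences $\lambda_p,\lambda_c>0$, $$\Psi_p(v_p,E)=-E^\top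 V_p-\mathbb E^{\mathbb P}[G]^\top F_p-\mathbb E^{\mathbb P}[G_{em}]^\top O_p-\tfrac{\lambda_p}2 v_p'^\top\hat Qv_p',\qquad \Psi_c(V_c,E)=-E^\top V_c-\tfrac{\lambda_c}2V_c^\top\hat Q_1V_c.$$ Optimal decisions at $E$ maximize $\Psi_p(\cdot,E)$ over $S_p$, resp. $\Psi_c(\cdot,E)$ over $S_c$. $\hat A_1\in\mathbb R^{|J|\times N}$ is the block-diagonal matrix whose $j$-th diagonal block is the row vector of ones of length $|I_j|$ (so $(\hat A_1V)_j=\sum_{i\in I_j}V(t_i,T_j)$). Assumption (A): for every $p\in P$ there is $v_p$ satisfying all equality constraints of $S_p$ and all its inequality constraints strictly; for every $c\in C$ there is $V_c$ satisfying the equality constraints of $S_c$ and its inequality constraints strictly; and these can be chosen such that $\sum_{c}V_c(t_i,T_j)+\sum_pV_p(t_i,T_j)=0$ for all $j\in J$, $i\in I_j$. Assumption (B): none of the random variables among the entries of $\Pi$, $G$, $G_{em}$ can be written as a linear combination of the others a.s. Convention (K): $F_{trade},V_{trade}$ are chosen so large that the trading bounds are never active at the optimal decisions considered. Bounds: a plant $r\in R^{p,l}$ is at the upper (lower) bound at $T_j$ if for every $\epsilon>0$ the value $W_{p,l,r}(T_j)+\epsilon$ (resp. $W_{p,l,r}(T_j)-\epsilon$) is infeasible, i.e. no production schedule of that plant satisfying the ramping and capacity constraints takes that value at $T_j$. $\bar S_M\subset\mathbb R^N$ is the set of price vectors $E$ for which, in optimal decisions of the producers at $E$, the power plants are either all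 at the upper or all at the lower bound simultaneously for at least one delivery time $T_j$, $j\in J$. For $E\in\mathbb R^N\setminus\bar S_M$ the optimal volume $V_k$ of each $k\in P\cup C$ is unique and depends on $E$ in a $\mathbb{PC}^\infty$ way. A plant $r\in R^{p,l}$ has a strictly feasible optimal production at $T_j$ if in the optimal decision none of the ramping and capacity constraints involving $W_{p,l,r}(T_j)$ is active. $\mathbb{PC}^r$ functions: a continuous $f:S_1\to\mathbb R^N$ on an open set $S_1\subseteq\mathbb R^N$ is $\mathbb{PC}^r$ if for every $x\in S_1$ there are an open neighborhood $S_2\subseteq S_1$ of $x$ and finitely many $\mathbb C^r$ functions $f^i:S_2\to\mathbb R^N$, $i\in\mathcal I$ (selection functions at $x$), with $f(z)\in\{f^i(z):i\in\mathcal I\}$ for all $z\in S_2$. The selection function $f^i$ is essentially active at $x$ if $x\in\mathrm{cl}\,\mathrm{int}\{z\in S_2:f^i(z)=f(z)\}$; $\mathcal I^e(x)$ is the set of indices of essentially active selection functions at $x$.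
   Formalization: The selection functions of the sum Z̃ at E are taken to be sums of selection functions of the individual Z̃_k; with an arbitrary family for Z̃, kinks of different players can cancel, and |I^e(E)|=1 would not make the Jacobians of all Z̃_k exist. *)

(* Defs.v *)
From HB Require Import structures.
From mathcomp Require Import all_boot all_order all_algebra.
From mathcomp Require Import all_classical all_reals all_analysis.

Set Implicit Arguments.
Unset Strict Implicit.
Unset Printing Implicit Defensive.

Import Order.TTheory GRing.Theory Num.Theory.
Import numFieldNormedType.Exports.

Local Open Scope classical_set_scope.
Local Open Scope ring_scope.

(* Vectors are row vectors.  The library Jacobian ['J f x] acts on row vectors
   from the right ('D_v f x = v *m 'J f x), so the Jacobian matrix in the usual
   column convention, with entries d f_a / d x_b, is its transpose. *)
Definition Jac (R : realType) (n : nat) (f : 'rV[R]_n -> 'rV[R]_n)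
    (x : 'rV[R]_n) : 'M[R]_n := ('J f x)^T.

Definition dot (R : realType) (n : nat) (u v : 'rV[R]_n) : R :=
  (u *m v^T) 0 0.

Definition quad (R : realType) (n : nat) (A : 'M[R]_n) (x : 'rV[R]_n) : R :=
  (x *m A *m x^T) 0 0.

Definition covmx (d : measure_display) (T : measurableType d) (R : realType)
    (Pr : probability T R) (n : nat) (X : T -> 'rV[R]_n) : 'M[R]_n :=
  \matrix_(a, b) fine (covariance Pr (fun w => X w 0 a) (fun w => X w 0 b)).

(* In finite dimension the derivative of f is of class C^r on S iff each
   directional derivative x |-> 'D_v f x is. *)
Fixpoint class_C (R : realType) (n : nat) (r : nat) (S : set 'rV[R]_n)
    (f : 'rV[R]_n -> 'rV[R]_n) : Prop :=
  match r with
  | 0 => forall x, S x -> {for x, continuous f}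
  | r'.+1 => (forall x, S x -> differentiable f x) /\
             (forall v, class_C r' S (fun x => 'D_v f x))
  end.

Definition class_Cinfty (R : realType) (n : nat) (S : set 'rV[R]_n)
    (f : 'rV[R]_n -> 'rV[R]_n) : Prop := forall r, class_C r S f.

(* The functions fs i, restricted to the open neighbourhood S2 of x, form a
   finite family of C^infty selection functions at x of f : S1 -> R^n; values
   of f outside S1 and of fs i outside S2 are irrelevant. *)
Definition selection_at (R : realType) (n : nat) (S1 : set 'rV[R]_n)
    (f : 'rV[R]_n -> 'rV[R]_n) (x : 'rV[R]_n) (S2 : set 'rV[R]_n)
    (I : finType) (fs : I -> 'rV[R]_n -> 'rV[R]_n) : Prop :=
  [/\ open S2, S2 x, S2 `<=` S1,
      (forall i, class_Cinfty S2 (fs i)) &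
      (forall z, S2 z -> exists i, f z = fs i z)].

Definition PCinfty (R : realType) (n : nat) (S1 : set 'rV[R]_n)
    (f : 'rV[R]_n -> 'rV[R]_n) : Prop :=
  [/\ open S1,
      (forall x, S1 x -> {for x, continuous f}) &
      (forall x, S1 x -> exists (S2 : set 'rV[R]_n) (I : finType)
         (fs : I -> 'rV[R]_n -> 'rV[R]_n), selection_at S1 f x S2 fs)].

Definition essentially_active (R : realType) (n : nat)
    (f : 'rV[R]_n -> 'rV[R]_n) (S2 : set 'rV[R]_n)
    (fi : 'rV[R]_n -> 'rV[R]_n) (x : 'rV[R]_n) : Prop :=
  closure (interior [set z | S2 z /\ fi z = f z]) x.

Definition ess_index (R : realType) (n : nat) (f : 'rV[R]_n -> 'rV[R]_n)
    (S2 : set 'rV[R]_n) (I : finType) (fs : I -> 'rV[R]_n -> 'rV[R]_n)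
    (x : 'rV[R]_n) : {set I} :=
  finset (fun i => `[< essentially_active f S2 (fs i) x >]).

(* Selection functions of \sum_k Z k obtained from selection functions fs k of
   the summands: one for each choice t of a selection function for every k. *)
Definition sum_selection (R : realType) (n : nat) (K : finType)
    (I : K -> finType) (fs : forall k : K, I k -> 'rV[R]_n -> 'rV[R]_n)
    (t : {dffun forall k : K, I k}) (x : 'rV[R]_n) : 'rV[R]_n :=
  \sum_(k : K) fs k (t k) x.

(* Delivery times are indexed by J = 'I_(ndeliv M), fuels by 'I_(nfuel M) and
   trading times for delivery j by I_j = 'I_(ntrade j). *)
Record market (R : realType) := Market {
  ndeliv : nat;
  ntrade : 'I_ndeliv -> nat;
  nfuel : nat;
  producer : finType;
  consumer : finType;
  producer_nonempty : (0 < #|producer|)%N;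
  consumer_nonempty : (0 < #|consumer|)%N;
  plant : producer -> 'I_nfuel -> finType;

  deliv_time : 'I_ndeliv -> R;
  interest : R;

  mdisp : measure_display;
  Omega : measurableType mdisp;
  Pr : probability Omega R;
  elec_price : forall j, 'I_(ntrade j) -> {RV Pr >-> R};
  fuel_price : 'I_nfuel -> forall j, 'I_(ntrade j) -> {RV Pr >-> R};
  em_price : forall j, 'I_(ntrade j) -> {RV Pr >-> R};
  elec_L2 : forall j (i : 'I_(ntrade j)),
    (elec_price i : Omega -> R) \in Lfun Pr 2%:E;
  fuel_L2 : forall l j (i : 'I_(ntrade j)),
    (fuel_price l i : Omega -> R) \in Lfun Pr 2%:E;
  em_L2 : forall j (i : 'I_(ntrade j)),
    (em_price i : Omega -> R) \in Lfun Pr 2%:E;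

  demand : 'I_ndeliv -> R;
  share : consumer -> R;
  share_itv : forall c, 0 <= share c <= 1;
  share_sum : \sum_c share c = 1;

  heat_rate : forall p l, plant p l -> R;
  heat_rate_gt0 : forall p l (r : plant p l), 0 < heat_rate r;
  em_rate : 'I_nfuel -> R;
  em_rate_gt0 : forall l, 0 < em_rate l;
  ramp_min : forall p l, plant p l -> R;
  ramp_max : forall p l, plant p l -> R;
  capacity : forall p l, plant p l -> R;
  F_trade : R;
  V_trade : R;
  F_trade_gt0 : 0 < F_trade;
  V_trade_gt0 : 0 < V_trade;

  risk_p : producer -> R;
  risk_c : consumer -> R;
  risk_p_gt0 : forall p, 0 < risk_p p;
  risk_c_gt0 : forall c, 0 < risk_c c
}.

(* R^N: the block vectors of the library, with consecutive blocks
   submxrow V j : 'rV_(ntrade j), j = 0, ..., ndeliv M - 1. *)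
Definition nvol (R : realType) (M : market R) : nat :=
  (\sum_(j < ndeliv M) ntrade j)%N.

Notation player M := (producer M + consumer M)%type.

Definition sum_trades (R : realType) (M : market R) (V : 'rV[R]_(nvol M))
    (j : 'I_(ndeliv M)) : R :=
  \sum_(i < ntrade j) submxrow V j 0 i.

Definition A1 (R : realType) (M : market R) : 'M[R]_(ndeliv M, nvol M) :=
  \matrix_(j < ndeliv M) \mxrow_(k < ndeliv M)
    (const_mx (j == k)%:R : 'rV[R]_(ntrade k)).

Section Prices.
Variables (R : realType) (M : market R).

Let N := nvol M.

Definition discount (j : 'I_(ndeliv M)) : R :=
  expR (- (interest M * deliv_time j)).

Definition disc_elec (w : Omega M) : 'rV[R]_N :=
  \mxrow_(j < ndeliv M) \row_(i < ntrade j) (discount j * elec_price i w).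

Definition disc_fuel (w : Omega M) : 'M[R]_(nfuel M, N) :=
  \matrix_(l < nfuel M) \mxrow_(j < ndeliv M)
    \row_(i < ntrade j) (discount j * fuel_price l i w).

Definition disc_em (w : Omega M) : 'rV[R]_N :=
  \mxrow_(j < ndeliv M) \row_(i < ntrade j) (discount j * em_price i w).

Definition disc_prices (w : Omega M) : 'rV[R]_(N + (nfuel M * N + N)) :=
  row_mx (disc_elec w) (row_mx (mxvec (disc_fuel w)) (disc_em w)).

Definition Qhat : 'M[R]_(N + (nfuel M * N + N)) := covmx (Pr M) disc_prices.

Definition Qhat1 : 'M[R]_N := covmx (Pr M) disc_elec.

Definition mean_fuel : 'M[R]_(nfuel M, N) :=
  \matrix_(l, a) fine (expectation (Pr M) (fun w => disc_fuel w l a)).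

Definition mean_em : 'rV[R]_N :=
  \row_a fine (expectation (Pr M) (fun w => disc_em w 0 a)).

End Prices.

Record decision (R : realType) (M : market R) (p : producer M) := Decision {
  vol : 'rV[R]_(nvol M);
  fuel_vol : 'M[R]_(nfuel M, nvol M);
  em_vol : 'rV[R]_(nvol M);
  output : forall l, plant p l -> 'I_(ndeliv M) -> R
}.

Section Constraints.
Variables (R : realType) (M : market R).

(* In this section cmp is <=%R for the constraints themselves and <%R for
   their strict versions. *)

Definition ramping_at (cmp : rel R) (p : producer M) (l : 'I_(nfuel M))
    (r : plant p l) (w : 'I_(ndeliv M) -> R) (j k : 'I_(ndeliv M)) : Prop :=
  cmp (ramp_min r) (w k - w j) /\ cmp (w k - w j) (ramp_max r).

Definition capacity_at (cmp : rel R) (p : producer M) (l : 'I_(nfuel M))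
    (r : plant p l) (w : 'I_(ndeliv M) -> R) (j : 'I_(ndeliv M)) : Prop :=
  cmp 0 (w j) /\ cmp (w j) (capacity r).

Definition schedule_ineq (cmp : rel R) (p : producer M) (l : 'I_(nfuel M))
    (r : plant p l) (w : 'I_(ndeliv M) -> R) : Prop :=
  (forall j k : 'I_(ndeliv M), k = j.+1 :> nat -> ramping_at cmp r w j k) /\
  (forall j, capacity_at cmp r w j).

Definition producer_trading (cmp : rel R) (p : producer M) (v : decision p)
  : Prop :=
  [/\ (forall l a, cmp `|fuel_vol v l a| (F_trade M)),
      (forall a, cmp `|em_vol v 0 a| (F_trade M)) &
      (forall a, cmp `|vol v 0 a| (V_trade M))].

Definition producer_ineq (cmp : rel R) (p : producer M) (v : decision p)
  : Prop :=
  (forall l (r : plant p l), schedule_ineq cmp r (output v r)) /\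
  producer_trading cmp v.

Definition producer_eq (p : producer M) (v : decision p) : Prop :=
  [/\ (forall j, - sum_trades (vol v) j =
         \sum_(l < nfuel M) \sum_(r : plant p l) output v r j),
      (forall j l, \sum_(r : plant p l) heat_rate r * output v r j =
         sum_trades (row l (fuel_vol v)) j) &
      \sum_(j < ndeliv M) sum_trades (em_vol v) j =
        \sum_(j < ndeliv M) \sum_(l < nfuel M) \sum_(r : plant p l)
          em_rate l * output v r j].

Definition producer_feasible (p : producer M) (v : decision p) : Prop :=
  producer_eq v /\ producer_ineq <=%R v.

Definition consumer_trading (cmp : rel R) (V : 'rV[R]_(nvol M)) : Prop :=
  forall a, cmp `|V 0 a| (V_trade M).

Definition consumer_eq (c : consumer M) (V : 'rV[R]_(nvol M)) : Prop :=
  forall j, sum_trades V j = share c * demand j.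

Definition consumer_feasible (c : consumer M) (V : 'rV[R]_(nvol M)) : Prop :=
  consumer_eq c V /\ consumer_trading <=%R V.

End Constraints.

Section Optimality.
Variables (R : realType) (M : market R).

Let N := nvol M.

Definition trades (p : producer M) (v : decision p)
  : 'rV[R]_(N + (nfuel M * N + N)) :=
  row_mx (vol v) (row_mx (mxvec (fuel_vol v)) (em_vol v)).

Definition Psi_p (p : producer M) (v : decision p) (E : 'rV[R]_N) : R :=
  - dot E (vol v) - dot (mxvec (mean_fuel M)) (mxvec (fuel_vol v))
  - dot (mean_em M) (em_vol v)
  - risk_p p / 2 * quad (Qhat M) (trades v).

Definition Psi_c (c : consumer M) (V E : 'rV[R]_N) : R :=
  - dot E V - risk_c c / 2 * quad (Qhat1 M) V.

Definition producer_optimal (p : producer M) (E : 'rV[R]_N) (v : decision p)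
  : Prop :=
  producer_feasible v /\
  forall v' : decision p, producer_feasible v' -> Psi_p v' E <= Psi_p v E.

Definition consumer_optimal (c : consumer M) (E V : 'rV[R]_N) : Prop :=
  consumer_feasible c V /\
  forall V' : 'rV[R]_N, consumer_feasible c V' -> Psi_c c V' E <= Psi_c c V E.

Definition optimal_volume (k : player M) (E V : 'rV[R]_N) : Prop :=
  match k with
  | inl p => exists2 v : decision p, producer_optimal E v & vol v = V
  | inr c => consumer_optimal c E V
  end.

Definition attainable (p : producer M) (l : 'I_(nfuel M)) (r : plant p l)
    (j : 'I_(ndeliv M)) (x : R) : Prop :=
  exists2 w : 'I_(ndeliv M) -> R, schedule_ineq <=%R r w & w j = x.

Definition at_upper (p : producer M) (v : decision p) (l : 'I_(nfuel M))
    (r : plant p l) (j : 'I_(ndeliv M)) : Prop :=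
  forall eps : R, 0 < eps -> ~ attainable r j (output v r j + eps).

Definition at_lower (p : producer M) (v : decision p) (l : 'I_(nfuel M))
    (r : plant p l) (j : 'I_(ndeliv M)) : Prop :=
  forall eps : R, 0 < eps -> ~ attainable r j (output v r j - eps).

(* Optimal production schedules need not be unique; E is excluded as soon as
   some optimal decisions put all plants at the same bound. *)
Definition S_M : set 'rV[R]_N :=
  [set E | exists v : forall p : producer M, decision p,
     (forall p, producer_optimal E (v p)) /\
     exists j : 'I_(ndeliv M),
       (forall p l (r : plant p l), at_upper (v p) r j) \/
       (forall p l (r : plant p l), at_lower (v p) r j)].

(* The ramping constraints involving the production at j are those between j
   and its successor and between j and its predecessor. *)
Definition strictly_feasible_production (p : producer M) (v : decision p)
    (l : 'I_(nfuel M)) (r : plant p l) (j : 'I_(ndeliv M)) : Prop :=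
  [/\ capacity_at <%R r (output v r) j,
      (forall k : 'I_(ndeliv M), k = j.+1 :> nat ->
         ramping_at <%R r (output v r) j k) &
      (forall i : 'I_(ndeliv M), j = i.+1 :> nat ->
         ramping_at <%R r (output v r) i j)].

End Optimality.

Arguments S_M {R} M.

Section Assumptions.
Variables (R : realType) (M : market R).

Definition assumption_A : Prop :=
  exists (v : forall p : producer M, decision p)
         (V : consumer M -> 'rV[R]_(nvol M)),
    [/\ (forall p, producer_eq (v p) /\ producer_ineq <%R (v p)),
        (forall c, consumer_eq c (V c) /\ consumer_trading <%R (V c)) &
        \sum_c V c + \sum_p vol (v p) = 0].

(* Discounting multiplies every price by a positive constant, so this is the
   same condition for discounted and undiscounted prices. *)
Definition assumption_B : Prop :=
  forall a, ~ exists c : 'rV[R]_(nvol M + (nfuel M * nvol M + nvol M)),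
    {ae Pr M, forall w,
       disc_prices w 0 a = \sum_(b | b != a) c 0 b * disc_prices w 0 b}.

Definition convention_K (E : 'rV[R]_(nvol M)) : Prop :=
  (forall (p : producer M) (v : decision p),
     producer_optimal E v -> producer_trading <%R v) /\
  (forall (c : consumer M) (V : 'rV[R]_(nvol M)),
     consumer_optimal c E V -> consumer_trading <%R V).

End Assumptions.

(* Main.v *)
Require Import Defs.
From HB Require Import structures.
From mathcomp Require Import all_boot all_order all_algebra.
From mathcomp Require Import all_classical all_reals all_analysis.
From mathcomp Require Import ring lra.

Set Implicit Arguments.
Unset Strict Implicit.
Unset Printing Implicit Defensive.

Import Order.TTheory GRing.Theory Num.Theory.
Import numFieldNormedType.Exports.

Local Open Scope classical_set_scope.
Local Open Scope ring_scope.

(** Write [phi e] for the optimal value of a producer at prices [e].  Each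
    feasible decision has a payoff that is affine in [e] with slope minus its
    volume, so [phi] is convex and, where [Z e] is an optimal volume, [- Z e]
    is a subgradient of [phi] at [e].  Hence, with [x] a price direction,

      phi (E + h x) + phi (E - h x) - 2 phi E
        <= - h x . (Z (E + h x) - Z (E - h x)) = - 2 h^2 x D x + o (h^2),

    where [D] is the Jacobian of [Z] at [E].  A lower bound for the same second
    difference comes from any direction [d] along which an optimal decision [v]
    at [E] can be moved both ways: testing [phi] with [v + h d] at [E + h x] and
    with [v - h d] at [E - h x] gives at least
    [- 2 h^2 (x . vol d + (risk / 2) quad Q d)], because all terms of first
    order in [h] cancel.  Letting [h] tend to 0,

      x D x <= x . vol d + (risk / 2) quad Q d      (quad_Jac_volume_le).

    The direction [d = 0] gives [x D x <= 0].  If [x D x = 0], replacing [x] by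
    its multiples forces [x . vol d = 0] for every such [d].  At a plant with
    strictly feasible production at [T_j] one such [d] lets the plant produce
    more and sells the output evenly over the trading times of [T_j]; its volume
    is minus row [j] of [A1], so for [x = y A1] the condition
    [x . vol d = 0] reads [y_j * |I_j| = 0].  A vector [y] in the kernel of the
    sum of the matrices [A1 D_p A1^T] annihilates each of the nonpositive terms
    [(y A1) D_p (y A1)^T], so [y = 0] and the sum has full rank.

    Differentiability of every [Z k] is a separate, topological matter: the sets
    on which all the [Z k] agree with a given choice of selection functions form
    a finite relatively closed cover of a neighbourhood of [E], so their
    interiors are dense there; when a single choice is essentially active, it
    represents all the [Z k] near [E]. *)

(** * Piecewise smooth maps with a single essentially active selection *)

Lemma near_eq_differentiable (R : numFieldType) (V W : normedModType R)
    (f g : V -> W) (x : V) :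
  {near x, f =1 g} -> differentiable f x -> differentiable g x.
Proof.
move=> fg df.
have dfc : continuous ('d f x) by exact: diff_continuous.
have gx : g \o shift x = cst (g x) + 'd f x +o_ 0 id.
  apply/eqaddoP => _/posnumP[e].
  have /eqaddoP/(_ e%:num)/(_ [gt0 of e%:num]) := diff_locally df.
  have fg0 : \forall h \near 0, f (h + x) = g (h + x).
    by have := fg; rewrite (near_shift 0 x); apply: filterS => h /=; rewrite subr0.
  apply: filterS2 fg0 => h /= fgh.
  by rewrite !fctE /= fgh (nbhs_singleton fg).
by apply/diff_locallyP; rewrite (diff_unique dfc gx).
Qed.

(** A Baire property of finite covers: if a nonempty open set is not contained in
    the first member of the cover, removing that member leaves a nonempty open
    set covered by the others. *)
Lemma finite_closed_cover_interior (T : topologicalType) (I : finType)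
    (S : set T) (C : I -> set T) (W : set T) :
  (forall i, open (S `\` C i)) -> open W -> W `<=` S -> W !=set0 ->
  (forall z, W z -> exists i, C i z) ->
  exists i, interior (W `&` C i) !=set0.
Proof.
move=> oC oW WS W0 cov.
suff gen : forall (s : seq I) (W' : set T), open W' -> W' `<=` W ->
    W' !=set0 -> (forall z, W' z -> exists2 i, i \in s & C i z) ->
    exists i, interior (W `&` C i) !=set0.
  apply: (gen (enum I) W) => // z /cov [i Ciz].
  by exists i => //; rewrite mem_enum.
elim=> [|i s IHs] W' oW' W'W [z W'z] cov'; first by have [] := cov' z W'z.
have [W'C|] := pselect (W' `<=` C i).
  exists i, z; move: W'z; rewrite -[W' z]/(W' z).
  suff : W' `<=` interior (W `&` C i) by apply.
  by rewrite -open_subsetE // => y W'y; split; [exact: W'W|exact: W'C].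
move=> /existsNP[y /not_implyP[W'y nCy]].
apply: (IHs (W' `&` (S `\` C i))).
- exact: openI.
- by move=> u [/W'W].
- by exists y; split => //; split => //; apply/WS/W'W.
- move=> u [W'u [_ nCu]]; have [k ks Ck] := cov' u W'u; exists k => //.
  by move: ks; rewrite inE => /predU1P[ki|//]; rewrite ki in Ck.
Qed.

(** If some point [z] near [x] escaped [C t0], a whole open set near [z] would lie
    in the interior of some [C t] with [t != t0]; such [t] are not essentially
    active at [x], so these interiors stay away from [x]. *)
Lemma unique_essential_selection_near (R : realType) (n : nat) (K : finType)
    (S1 S2 : set 'rV[R]_n) (Z : K -> 'rV[R]_n -> 'rV[R]_n) (x : 'rV[R]_n)
    (I : K -> finType) (fs : forall k, I k -> 'rV[R]_n -> 'rV[R]_n) :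
  (forall k, PCinfty S1 (Z k)) ->
  (forall k, selection_at S1 (Z k) x S2 (fs k)) -> open S2 -> S2 x ->
  #|ess_index (fun y => \sum_k Z k y) S2 (sum_selection fs) x| = 1%N ->
  exists t : {dffun forall k : K, I k},
    \forall z \near x, forall k, Z k z = fs k (t k) z.
Proof.
move=> ZPC Zsel oS2 S2x /eqP/cards1P[t0 t0E]; exists t0.
pose C (t : {dffun forall k : K, I k}) := [set z | forall k, Z k z = fs k (t k) z].
pose A (t : {dffun forall k : K, I k}) :=
  [set z | S2 z /\ sum_selection fs t z = \sum_k Z k z].
(* [C t] asks for agreement of every summand, [A t] only for agreement of the
   sums: the covering argument needs the former, essential activity is about the
   latter. *)
have oC t : open (S2 `\` C t).
  rewrite openE => z [S2z /existsNP[k /eqP nZ]].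
  have [_ _ S21 fsC _] := Zsel k; have [_ Zc _] := ZPC k.
  have cZ : {for z, continuous (Z k)} by apply/Zc/S21.
  have cf : {for z, continuous (fs k (t k))} by have := fsC (t k) 0%N; apply.
  have ne0 : \forall y \near z, Z k y - fs k (t k) y != 0.
    by apply: cvgr_neq0 (cvgB cZ cf) _; rewrite subr_eq0.
  have S2n : \forall y \near z, S2 y by exact: open_nbhs_nbhs.
  apply: filterS2 S2n ne0 => y S2y; rewrite subr_eq0 => /eqP ne.
  by split => // /(_ k).
have cov z : S2 z -> exists t, C t z.
  move=> S2z.
  have Zf k : exists i, Z k z = fs k i z by have [_ _ _ _ /(_ z S2z)] := Zsel k.
  have [g gP] := fin_all_exists Zf.
  by exists (finfun g) => k; rewrite ffunE.
have CA t : S2 `&` C t `<=` A t.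
  by move=> z [S2z Ctz]; split => //; apply: eq_bigr => k _; rewrite Ctz.
have away t : \forall z \near x, t != t0 -> ~ closure (interior (A t)) z.
  have [->|tt0] := eqVneq t t0.
    by apply: (@filterE _ (nbhs x)) => z /eqP.
  have nAx : ~ closure (interior (A t)) x.
    move=> clx; move/setP/(_ t): t0E.
    by rewrite !inE (negbTE tt0) => /asboolPn; apply.
  have : open (~` closure (interior (A t))).
    exact/closed_openC/closed_closure.
  by rewrite openE => /(_ x nAx); apply: filterS.
have S2n : \forall y \near x, S2 y by exact: open_nbhs_nbhs.
have : \forall z \near x, S2 z /\
    forall t, t != t0 -> ~ closure (interior (A t)) z.
  by apply: filterS2 S2n (filter_forall _ away) => y; split.
rewrite -nbhs_nearE nbhsE => -[U [oU Ux] UP].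
rewrite -nbhs_nearE nbhsE; exists U => // z Uz; apply: contrapT => nCz.
have US : U `<=` S2 by move=> y /UP[].
have oW : open (U `&` (S2 `\` C t0)) by exact: openI.
have [t [y yW]] : exists t, interior (U `&` (S2 `\` C t0) `&` C t) !=set0.
  apply: (@finite_closed_cover_interior _ _ S2) => //.
  - by move=> y [/US].
  - by exists z; split => //; split => //; exact: US.
  - by move=> y [/US/cov].
have [[Uy [S2y nC0]] Cy] := interior_subset yW.
have tt0 : t != t0 by apply: contra_not_neq nC0 => <-.
have [_ /(_ t tt0)] := UP y Uy; apply.
apply: subset_closure; apply: interiorS yW => u [[_ [S2u _]] Cu].
exact: CA.
Qed.

(** * Scalar products, quadratic forms and symmetric differences *)

Section DotQuad.
Context {R : realType} {n : nat}.
Implicit Types (u v w : 'rV[R]_n) (A : 'M[R]_n) (a : R).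

Lemma dotC u v : dot u v = dot v u.
Proof. by rewrite /dot -[in LHS](trmxK u) -trmx_mul mxE. Qed.

Lemma dotDl u v w : dot (u + v) w = dot u w + dot v w.
Proof. by rewrite /dot mulmxDl mxE. Qed.

Lemma dotZl a u w : dot (a *: u) w = a * dot u w.
Proof. by rewrite /dot -scalemxAl mxE. Qed.

Lemma dotDr u v w : dot w (u + v) = dot w u + dot w v.
Proof. by rewrite !(dotC w) dotDl. Qed.

Lemma dotZr a u w : dot w (a *: u) = a * dot w u.
Proof. by rewrite !(dotC w) dotZl. Qed.

Lemma dotBr u v w : dot w (u - v) = dot w u - dot w v.
Proof. by rewrite dotDr -scaleN1r dotZr mulN1r. Qed.

Lemma dot_continuous u : continuous (dot u).
Proof.
have -> : dot u = fun v => \sum_i u 0 i * v 0 i.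
  by apply/funext => v; rewrite /dot mxE; apply: eq_bigr => i _; rewrite mxE.
apply: (continuous_big (@add_continuous R)) => i _ v.
exact: (cvgM (cvg_cst (u 0 i)) (@coord_continuous _ _ _ 0 i v)).
Qed.

Lemma quad_parallelogram A u w a :
  quad A (u + a *: w) + quad A (u + (- a) *: w) =
  2 * quad A u + 2 * a ^+ 2 * quad A w.
Proof.
rewrite /quad !linearD !linearZ /= !(mulmxDl, mulmxDr).
rewrite -!(scalemxAl, scalemxAr) !mxE; ring.
Qed.

(** The symmetric difference quotient along [x] tends to twice the directional
    derivative, whose scalar product with [x] is the quadratic form of the
    Jacobian. *)
Lemma quad_Jac_le (f : 'rV[R]_n -> 'rV[R]_n) (e x : 'rV[R]_n) (c : R) :
  differentiable f e ->
  (\forall h \near 0^',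
     h * dot x (f (h *: x + e) - f (h *: - x + e)) <= 2 * h ^+ 2 * c) ->
  quad (Jac f e) x <= c.
Proof.
move=> df hc.
have cv y : (fun h : R => h^-1 *: (f (h *: y + e) - f e)) @ 0^' -->
    y *m jacobian f e.
  by rewrite -deriveEjacobian //; exact: (@diff_derivable _ _ _ _ _ y df).
have lim : (fun h : R => dot x (h^-1 *: (f (h *: x + e) - f e) -
      h^-1 *: (f (h *: - x + e) - f e))) @ 0^' --> 2 * quad (Jac f e) x.
  have -> : 2 * quad (Jac f e) x =
      dot x (x *m jacobian f e - - x *m jacobian f e).
    rewrite mulNmx opprK dotDr mulr_natl mulr2n.
    by rewrite /dot /quad /Jac trmx_mul mulmxA.
  exact: (continuous_cvg _ (@dot_continuous x _) (cvgB (cv x) (cv (- x)))).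
rewrite -(ler_pM2l (ltr0n R 2)).
apply: (cvgr_to_le lim).
have h0 : \forall h \near (0 : R)^', h != 0 by exact: nbhs_dnbhs_neq.
apply: filterS2 h0 hc => h h0 hc.
rewrite -scalerBr opprB addrA subrK dotZr.
rewrite -(ler_pM2l (_ : 0 < h ^+ 2)) ?exprn_even_gt0 //.
by rewrite expr2 -mulrA mulVKf // mulrA (mulrC (h * h)) -expr2.
Qed.

End DotQuad.

(** * Inequalities that survive small perturbations *)

(** A constraint that does not involve the perturbation may be active; the others
    need slack. *)
Lemma near0_affine_le (R : realType) (a b c : R) :
  a <= c -> (b != 0 -> a < c) -> \forall s \near (0 : R), a + s * b <= c.
Proof.
move=> ac; have [->|b0 /(_ isT) ltac] := eqVneq b 0.
  by move=> _; near=> s; rewrite mulr0 addr0.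
have lim : a + s * b @[s --> 0] --> a + 0 * b.
  by apply: cvgD; [exact: cvg_cst | apply: cvgM; [exact: cvg_id | exact: cvg_cst]].
by apply: cvgr_le lim _ _; rewrite mul0r addr0.
Unshelve. all: by end_near. Qed.

Lemma near0_forall (R : realType) (I : finType) (P : I -> R -> Prop) :
  (forall i, \forall s \near (0 : R), P i s) ->
  \forall s \near (0 : R), forall i, P i s.
Proof. exact: (@filter_forall _ _ _ _ (nbhs_filter (0 : R))). Qed.

Lemma near0_affine_norm_le (R : realType) (a b c : R) :
  `|a| < c -> \forall s \near (0 : R), `|a + s * b| <= c.
Proof.
rewrite ltr_norml => /andP[ca ac].
have up : \forall s \near (0 : R), a + s * b <= c by exact: near0_affine_le (ltW ac) _.
have lo : \forall s \near (0 : R), - a + s * - b <= c.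
  by apply: near0_affine_le => [|_]; rewrite ?ltW // ltrNl.
by apply: filterS2 up lo => s up lo; rewrite ler_norml up lerNl opprD -mulrN lo.
Qed.

(** * Moving an optimal decision in two opposite directions *)

Lemma sum_trades_scale (R : realType) (M : market R) (a : R)
    (V : 'rV[R]_(nvol M)) j :
  sum_trades (a *: V) j = a * sum_trades V j.
Proof.
by rewrite /sum_trades mulr_sumr; apply: eq_bigr => i _; rewrite !mxE.
Qed.

Section Directions.
Context {R : realType} {M : market R} {p : producer M}.
Implicit Types (v d : decision p) (s : R).

Definition move_along v d s : decision p := Decision
  (vol v + s *: vol d) (fuel_vol v + s *: fuel_vol d) (em_vol v + s *: em_vol d)
  (fun l r j => output v r j + s * output d r j).

Lemma trades_move_along v d s :
  trades (move_along v d s) = trades v + s *: trades d.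
Proof. by rewrite /trades /= linearD linearZ /= !scale_row_mx !add_row_mx. Qed.

Lemma sum_trades_move (V W : 'rV[R]_(nvol M)) s j :
  sum_trades (V + s *: W) j = sum_trades V j + s * sum_trades W j.
Proof.
rewrite /sum_trades mulr_sumr -big_split; apply: eq_bigr => i _.
by rewrite !mxE.
Qed.

(** The equality constraints of a producer are linear and homogeneous, so they
    serve both as constraints on decisions and as the condition on directions. *)
Lemma producer_eq_move_along v d s :
  producer_eq v -> producer_eq d -> producer_eq (move_along v d s).
Proof.
move=> [vV vF vO] [dV dF dO]; split => /= [j|j l|].
- rewrite sum_trades_move opprD -mulrN vV dV mulr_sumr -big_split.
  by apply: eq_bigr => l _; rewrite mulr_sumr -big_split.
- rewrite !linearD !linearZ /= sum_trades_move -vF -dF mulr_sumr -big_split.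
  by apply: eq_bigr => r _ /=; ring.
- under eq_bigr do rewrite sum_trades_move.
  rewrite big_split -mulr_sumr /= vO dO mulr_sumr -big_split.
  apply: eq_bigr => j _; rewrite mulr_sumr -big_split.
  apply: eq_bigr => l _; rewrite mulr_sumr -big_split.
  by apply: eq_bigr => r _ /=; ring.
Qed.

(** The payoff is quadratic in decision and prices jointly, so its symmetric
    second difference is exact and only the price-volume product and the risk
    term contribute to it. *)
Lemma Psi_p_second_difference v d (E x : 'rV[R]_(nvol M)) s :
  Psi_p (move_along v d s) (s *: x + E) +
  Psi_p (move_along v d (- s)) (s *: - x + E) =
  2 * Psi_p v E - 2 * s ^+ 2 *
    (dot x (vol d) + risk_p p / 2 * quad (Qhat M) (trades d)).
Proof.
rewrite /Psi_p !trades_move_along /=.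
have Q2 := quad_parallelogram (Qhat M) (trades v) (trades d) s.
have -> : quad (Qhat M) (trades v + s *: trades d) =
    2 * quad (Qhat M) (trades v) + 2 * s ^+ 2 * quad (Qhat M) (trades d) -
    quad (Qhat M) (trades v + (- s) *: trades d) by rewrite -Q2 addrK.
have mxD t : mxvec (fuel_vol v + t *: fuel_vol d) =
    mxvec (fuel_vol v) + t *: mxvec (fuel_vol d) by rewrite linearD linearZ.
rewrite !mxD -(scaleN1r x) !(dotDl, dotDr, dotZl, dotZr).
move: (quad _ _) (quad _ _) (quad _ _) => q1 q2 q3.
by field.
Qed.

(** Only the ramping and capacity constraints that the direction actually moves
    have to be inactive. *)
Definition slack_along v d : Prop :=
  (forall l (r : plant p l) (j k : 'I_(ndeliv M)), k = j.+1 :> nat ->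
     output d r k - output d r j != 0 -> ramping_at <%R r (output v r) j k) /\
  (forall l (r : plant p l) j,
     output d r j != 0 -> capacity_at <%R r (output v r) j).

Lemma near0_feasible v d :
  producer_feasible v -> producer_trading <%R v ->
  producer_eq d -> slack_along v d ->
  \forall s \near (0 : R), producer_feasible (move_along v d s).
Proof.
move=> [veq [vin _]] [tF tO tV] deq [dramp dcap].
have ramp (l : 'I_(nfuel M)) (r : plant p l) (j k : 'I_(ndeliv M)) :
    \forall s \near (0 : R), k = j.+1 :> nat ->
      ramping_at <=%R r (output (move_along v d s) r) j k.
  have [kj|/eqP kj] := eqVneq (k : nat) j.+1; last first.
    by apply: (@filterE _ (nbhs (0 : R))).
  have [/(_ j k kj)[rlo rup] _] := vin l r.
  have lo : \forall s \near (0 : R), - (output v r k - output v r j) +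
      s * - (output d r k - output d r j) <= - ramp_min r.
    apply: near0_affine_le; first by rewrite lerN2.
    by rewrite oppr_eq0 ltrN2 => /(dramp _ _ _ _ kj)[].
  have up : \forall s \near (0 : R), (output v r k - output v r j) +
      s * (output d r k - output d r j) <= ramp_max r.
    by apply: near0_affine_le => // /(dramp _ _ _ _ kj)[].
  apply: filterS2 lo up => s lo up _; split; rewrite /=; lra.
have cap (l : 'I_(nfuel M)) (r : plant p l) (j : 'I_(ndeliv M)) :
    \forall s \near (0 : R), capacity_at <=%R r (output (move_along v d s) r) j.
  have [_ /(_ j)[rlo rup]] := vin l r.
  have lo : \forall s \near (0 : R), - output v r j + s * - output d r j <= 0.
    apply: near0_affine_le; first by rewrite oppr_le0.
    by rewrite oppr_eq0 oppr_lt0 => /(dcap _ _ _)[].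
  have up : \forall s \near (0 : R), output v r j + s * output d r j <= capacity r.
    by apply: near0_affine_le => // /(dcap _ _ _)[].
  apply: filterS2 lo up => s lo up; split; rewrite /=; lra.
have ramps := near0_forall (fun l => near0_forall (fun r =>
  near0_forall (fun j => near0_forall (ramp l r j)))).
have caps := near0_forall (fun l => near0_forall (fun r =>
  near0_forall (cap l r))).
have fuels := near0_forall (fun l => near0_forall (fun a =>
  near0_affine_norm_le (fuel_vol d l a) (tF l a))).
have ems := near0_forall (fun a =>
  near0_affine_norm_le (em_vol d 0 a) (tO a)).
have vols := near0_forall (fun a =>
  near0_affine_norm_le (vol d 0 a) (tV a)).
have trad : \forall s \near (0 : R), producer_trading <=%R (move_along v d s).
  apply: filterS3 fuels ems vols => s fs es vs.
  by split => [l a|a|a]; rewrite !mxE; [exact: fs|exact: es|exact: vs].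
apply: filterS3 ramps caps trad => s sramp scap strad.
split; first exact: producer_eq_move_along.
split => // l r; split => [j k|j]; [exact: sramp|exact: scap].
Qed.

(** Upper bound on the second difference of the optimal value from the
    subgradients [- Z], lower bound from the two test decisions [v + h d] and
    [v - h d]. *)
Lemma quad_Jac_volume_le v d (Z : 'rV[R]_(nvol M) -> 'rV[R]_(nvol M))
    (E x : 'rV[R]_(nvol M)) :
  differentiable Z E ->
  (\forall e \near E, exists2 u : decision p, producer_optimal e u & vol u = Z e) ->
  producer_optimal E v -> producer_trading <%R v ->
  producer_eq d -> slack_along v d ->
  quad (Jac Z E) x <=
    dot x (vol d) + risk_p p / 2 * quad (Qhat M) (trades d).
Proof.
move=> dZ optZ [vfeas vopt] vtr deq dsl.
have feas := near0_feasible vfeas vtr deq dsl.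
have feasN : \forall s \near (0 : R), producer_feasible (move_along v d (- s)).
  have lim : - s @[s --> (0 : R)] --> (0 : R).
    by rewrite -[X in _ --> X]oppr0; apply: cvgN; exact: cvg_id.
  exact: (lim _ feas).
have optx (y : 'rV[R]_(nvol M)) : \forall h \near (0 : R),
    exists2 u : decision p, producer_optimal (h *: y + E) u &
      vol u = Z (h *: y + E).
  have lim : h *: y + E @[h --> (0 : R)] --> E.
    rewrite -[X in _ --> X]add0r -(scale0r y).
    by apply: cvgD; [apply: cvgZr_tmp; exact: cvg_id | exact: cvg_cst].
  exact: (lim _ optZ).
apply: quad_Jac_le => //; apply: nbhs_dnbhs.
apply: filterS2 (filterI feas feasN) (filterI (optx x) (optx (- x))).
move=> h [hf hNf] [[u1 [u1f u1o] u1Z] [u2 [u2f u2o] u2Z]].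
have shifted1 := u1o _ hf; have shifted2 := u2o _ hNf.
(* Both optimal decisions at the shifted prices are feasible at [E] as well. *)
have at_E1 := vopt _ u1f; have at_E2 := vopt _ u2f.
have S2 := Psi_p_second_difference v d E x h.
have C1 : Psi_p u1 (h *: x + E) = Psi_p u1 E - h * dot x (Z (h *: x + E)).
  by rewrite -u1Z /Psi_p dotDl dotZl; ring.
have C2 : Psi_p u2 (h *: - x + E) = Psi_p u2 E + h * dot x (Z (h *: - x + E)).
  by rewrite -u2Z /Psi_p -(scaleN1r x) dotDl !dotZl; ring.
rewrite dotBr mulrBr; lra.
Qed.

End Directions.

(** The case of the zero direction. *)
Lemma quad_Jac_volume_le0 (R : realType) (M : market R) (p : producer M)
    (v : decision p) (Z : 'rV[R]_(nvol M) -> 'rV[R]_(nvol M))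
    (E x : 'rV[R]_(nvol M)) :
  differentiable Z E ->
  (\forall e \near E, exists2 u : decision p, producer_optimal e u & vol u = Z e) ->
  producer_optimal E v -> producer_trading <%R v ->
  quad (Jac Z E) x <= 0.
Proof.
move=> dZ optZ vopt vtr.
pose d : decision p := Decision 0 0 0 (fun _ _ _ => 0).
have st0 j : sum_trades (0 : 'rV[R]_(nvol M)) j = 0.
  by rewrite -(scale0r 0) sum_trades_scale mul0r.
have deq : producer_eq d.
  split => /= [j|j l|].
  - by rewrite st0 oppr0 big1 // => l _; rewrite big1.
  - by rewrite row0 st0 big1 // => r _; rewrite mulr0.
  - rewrite big1 => [|j _]; last exact: st0.
    rewrite big1 // => j _; rewrite big1 // => l _.
    by rewrite big1 // => r _; rewrite mulr0.
have dsl : slack_along v d.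
  by split => [l r j k _|l r j] /=; rewrite ?subrr eqxx.
have := quad_Jac_volume_le x dZ optZ vopt vtr deq dsl.
have -> : trades d = 0 by rewrite /trades /= linear0 !row_mx0.
have -> : dot x (vol d) = 0 by rewrite /dot /= trmx0 mulmx0 mxE.
have -> : quad (Qhat M) 0 = 0 by rewrite /quad trmx0 mulmx0 mxE.
by rewrite mulr0 addr0.
Qed.

(** Replacing [x] by [k x] scales the volume term of [quad_Jac_volume_le] by [k]
    and leaves the risk term alone, while the left-hand side stays 0. *)
Lemma quad_Jac_volume_eq0 (R : realType) (M : market R) (p : producer M)
    (v d : decision p) (Z : 'rV[R]_(nvol M) -> 'rV[R]_(nvol M))
    (E x : 'rV[R]_(nvol M)) :
  differentiable Z E ->
  (\forall e \near E, exists2 u : decision p, producer_optimal e u & vol u = Z e) ->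
  producer_optimal E v -> producer_trading <%R v ->
  producer_eq d -> slack_along v d ->
  quad (Jac Z E) x = 0 -> dot x (vol d) = 0.
Proof.
move=> dZ optZ vopt vtr deq dsl q0.
set b := dot x (vol d).
pose c := risk_p p / 2 * quad (Qhat M) (trades d).
have ineq k : 0 <= k * b + c.
  have := quad_Jac_volume_le (k *: x) dZ optZ vopt vtr deq dsl.
  rewrite dotZl -/b -/c; apply: le_trans.
  have -> : quad (Jac Z E) (k *: x) = k ^+ 2 * quad (Jac Z E) x.
    by rewrite /quad linearZ /= -!(scalemxAl, scalemxAr) !mxE mulrA expr2.
  by rewrite q0 mulr0.
apply/eqP; apply: contraT => b0.
(* This multiple makes the right-hand side equal to -1. *)
have := ineq (- (c + 1) / b).
by rewrite divfK //; lra.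
Qed.

(** * Ramping up one plant *)

Lemma sum_trades_A1 (R : realType) (M : market R) (j k : 'I_(ndeliv M)) :
  sum_trades (row j (A1 M)) k = (k == j)%:R * (ntrade j)%:R.
Proof.
rewrite /sum_trades /A1 rowK mxrowK.
under eq_bigr do rewrite mxE.
rewrite sumr_const card_ord eq_sym.
by case: eqP => [->|_]; rewrite ?mul1r // mul0r mul0rn.
Qed.

Lemma mulmx_A1_tr (R : realType) (M : market R) (V : 'rV[R]_(nvol M)) j :
  (A1 M *m V^T) j 0 = sum_trades V j.
Proof.
transitivity ((row j (A1 M) *m V^T) 0 0); first by rewrite -row_mul [RHS]mxE.
rewrite rowK -[in LHS](submxrowK V) tr_mxrow mul_mxrow_mxcol summxE.
rewrite (bigD1 j) //= [X in _ + X]big1 => [|k kj].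
  by rewrite addr0 mxE; apply: eq_bigr => i _; rewrite !mxE eqxx mul1r.
by rewrite mxE big1 // => i _; rewrite mxE eq_sym (negbTE kj) mul0r.
Qed.

Section RampUp.
Context {R : realType} {M : market R} {p : producer M}.
Context {l0 : 'I_(nfuel M)} (r0 : plant p l0) (j0 : 'I_(ndeliv M)).

Definition is_ramped l (r : plant p l) (j : 'I_(ndeliv M)) : bool :=
  (Tagged (plant p) r == Tagged (plant p) r0) && (j == j0).

(** The plant [r0] raises its production at [j0] by [ntrade j0], so that one unit
    is sold and [heat_rate r0], resp. [em_rate l0], units of fuel and emission
    certificates are bought at each trading time for [j0]. *)
Definition ramp_up : decision p := Decision
  (- row j0 (A1 M))
  (\matrix_(l, a) ((l == l0)%:R * heat_rate r0 * A1 M j0 a))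
  (em_rate l0 *: row j0 (A1 M))
  (fun l r j => (is_ramped r j)%:R * (ntrade j0)%:R).

Lemma sum_ramped (f : forall l, plant p l -> R) j :
  \sum_(l < nfuel M) \sum_(r : plant p l) f l r * (is_ramped r j)%:R =
  (j == j0)%:R * f l0 r0.
Proof.
rewrite sig_big_dep /= (bigD1 (Tagged (plant p) r0)) //= big1 => [|[l r] /= ne].
  by rewrite /is_ramped eqxx /= addr0 mulrC.
by rewrite /is_ramped (negbTE ne) mulr0.
Qed.

Lemma ramp_up_eq : producer_eq ramp_up.
Proof.
split => /= [j|j l|].
- rewrite -(scaleN1r (row _ _)) sum_trades_scale sum_trades_A1 mulN1r opprK.
  under eq_bigr do under eq_bigr do rewrite mulrC.
  by rewrite (sum_ramped (fun _ _ => _)).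
- have -> : row l (\matrix_(l, a) ((l == l0)%:R * heat_rate r0 * A1 M j0 a)) =
      ((l == l0)%:R * heat_rate r0) *: row j0 (A1 M).
    by apply/rowP => a; rewrite !mxE.
  rewrite sum_trades_scale sum_trades_A1.
  have [ll0|ll0] := eqVneq l l0; last first.
    rewrite !mul0r big1 // => r _; rewrite /is_ramped -tag_eqE /tag_eq /=.
    by rewrite (negbTE ll0) !mul0r mulr0.
  subst l; rewrite (bigD1 r0) //= big1 => [|r rr0].
    by rewrite /is_ramped eqxx /= addr0 mul1r.
  by rewrite /is_ramped eq_Tagged /= (negbTE rr0) mul0r mulr0.
- apply: eq_bigr => j _; rewrite sum_trades_scale sum_trades_A1.
  under eq_bigr do under eq_bigr do rewrite mulrA mulrAC.
  rewrite (sum_ramped (fun l _ => em_rate l * (ntrade j0)%:R)).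
  by rewrite mulrCA.
Qed.

Lemma ramp_up_slack (v : decision p) :
  strictly_feasible_production v r0 j0 -> slack_along v ramp_up.
Proof.
move=> [cap next prev].
(* [Tagged] equality of plants transports properties across fuels. *)
have ind (P : forall l, plant p l -> Prop) l (r : plant p l) :
    Tagged (plant p) r = Tagged (plant p) r0 -> P l0 r0 -> P l r.
  pose Q (u : {l & plant p l}) := P (tag u) (tagged u).
  by move=> e P0; rewrite -[P l r]/(Q (Tagged (plant p) r)) e.
split => [l r j k kj|l r j] /=; rewrite /is_ramped;
  case: (Tagged (plant p) r =P Tagged (plant p) r0) => [e|_] /=;
  rewrite ?mul0r ?subrr ?eqxx //.
- move=> ne; apply: (ind (fun l r => ramping_at <%R r (output v r) j k) _ _ e).
  have [kj0|kj0] := eqVneq k j0; first by subst k; exact: prev.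
  have [jj0|jj0] := eqVneq j j0; first by subst j; exact: next.
  by move: ne; rewrite (negbTE kj0) (negbTE jj0) mul0r subrr eqxx.
- case: (j =P j0) => [->|_]; last by rewrite mul0r eqxx.
  by move=> _; exact: (ind (fun l r => capacity_at <%R r (output v r) j0)).
Qed.

(** Without trading times nothing can be sold, hence nothing is produced. *)
Lemma strictly_feasible_ntrade (v : decision p) :
  producer_feasible v -> strictly_feasible_production v r0 j0 ->
  (0 < ntrade j0)%N.
Proof.
move=> [[vV _ _] [vin _]] [[w0 _] _ _].
have out_ge0 l (r : plant p l) : 0 <= output v r j0.
  by have [_ /(_ j0)[]] := vin l r.
rewrite lt0n; apply/eqP => n0.
have : 0 < \sum_(l < nfuel M) \sum_(r : plant p l) output v r j0.
  rewrite (bigD1 l0) //= (bigD1 r0) //= -addrA ltr_wpDr //.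
  by apply: addr_ge0; apply: sumr_ge0 => l _ //; apply: sumr_ge0.
rewrite -vV /sum_trades big1 ?oppr0 ?ltxx // => i _.
by have := ltn_ord i; rewrite {2}n0.
Qed.

End RampUp.

(** * Monotonicity and full rank *)

(* The selection functions of \sum_k Z k at E are the sums of selection
   functions of the Z k.  With a family unrelated to the players, kinks of
   different players could cancel in the sum, and |I^e(E)| = 1 would not give
   the differentiability of each Z k. *)
Theorem theorem3p26 (R : realType) (M : market R)
    (hA : assumption_A M) (hB : assumption_B M)
    (Z : player M -> 'rV[R]_(nvol M) -> 'rV[R]_(nvol M))
    (hZ : forall k E, ~ S_M M E -> optimal_volume k E (Z k E))
    (hPC : forall k, PCinfty (~` S_M M) (Z k))
    (E : 'rV[R]_(nvol M)) (hE : ~ S_M M E) (hK : convention_K E)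
    (S2 : set 'rV[R]_(nvol M)) (I : player M -> finType)
    (fs : forall k, I k -> 'rV[R]_(nvol M) -> 'rV[R]_(nvol M))
    (hfs : forall k, selection_at (~` S_M M) (Z k) E S2 (fs k))
    (hIe : #|ess_index (fun x => \sum_k Z k x) S2 (sum_selection fs) E| = 1%N) :
  [/\ (forall k, differentiable (Z k) E),
      (forall (p : producer M) (x : 'rV[R]_(nvol M)),
         quad (Jac (Z (inl p)) E) x <= 0) &
      (forall j : 'I_(ndeliv M),
         exists (p : producer M) (v : decision p) (l : 'I_(nfuel M))
                (r : plant p l),
           producer_optimal E v /\ strictly_feasible_production v r j) ->
      \rank (\sum_(p : producer M)
               A1 M *m Jac (Z (inl p)) E *m (A1 M)^T)%R = ndeliv M].
Proof.
have /card_gt0P[p0 _] := producer_nonempty M.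
have [oS2 S2E _ _ _] := hfs (inl p0).
have [t tP] := unique_essential_selection_near hPC hfs oS2 S2E hIe.
have dZ k : differentiable (Z k) E.
  have [_ _ _ fsC _] := hfs k.
  have [dfs _] := fsC (t k) 1%N.
  apply: near_eq_differentiable (dfs E S2E).
  by apply: filterS tP => z ->.
have optZ (p : producer M) : \forall e \near E,
    exists2 u : decision p, producer_optimal e u & vol u = Z (inl p) e.
  have [oS _ _] := hPC (inl p).
  have nS : \forall e \near E, (~` S_M M) e by exact: open_nbhs_nbhs.
  by apply: filterS nS => e /(hZ (inl p)).
have neg (p : producer M) x : quad (Jac (Z (inl p)) E) x <= 0.
  have [v vopt _] := hZ (inl p) E hE.
  exact: quad_Jac_volume_le0 (dZ _) (optZ p) vopt (hK.1 p v vopt).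
split => // plants; apply/eqP; apply: inj_row_free => y y0.
(* Summed over the producers, these nonpositive numbers give the quadratic form
   at [y] of a matrix annihilated by [y]. *)
have quad0 (p : producer M) : quad (Jac (Z (inl p)) E) (y *m A1 M) = 0.
  have sum0 : \sum_(q : producer M) - quad (Jac (Z (inl q)) E) (y *m A1 M) = 0.
    transitivity (- (y *m (\sum_(q : producer M)
        A1 M *m Jac (Z (inl q)) E *m (A1 M)^T) *m y^T) 0 0).
      rewrite mulmx_sumr mulmx_suml summxE sumrN; congr (- _).
      by apply: eq_bigr => q _; rewrite /quad trmx_mul !mulmxA.
    by rewrite y0 mul0mx mxE oppr0.
  apply/eqP; rewrite -oppr_eq0; apply/eqP.
  apply: (psumr_eq0P _ sum0) => // q _.
  by rewrite oppr_ge0.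
apply/rowP => j; rewrite mxE.
have [p [v [l [r [vopt sfp]]]]] := plants j.
have := quad_Jac_volume_eq0 (dZ _) (optZ p) vopt (hK.1 p v vopt)
  (ramp_up_eq r j) (ramp_up_slack sfp) (quad0 p).
have n0 := strictly_feasible_ntrade vopt.1 sfp.
have -> : dot (y *m A1 M) (vol (ramp_up r j)) = - (y 0 j * (ntrade j)%:R).
  rewrite /= -scaleN1r dotZr mulN1r /dot -mulmxA mxE (bigD1 j) //=.
  rewrite big1 => [|k kj]; rewrite mulmx_A1_tr sum_trades_A1.
    by rewrite eqxx mul1r addr0.
  by rewrite (negbTE kj) mul0r mulr0.
move/eqP; rewrite oppr_eq0 mulf_eq0 pnatr_eq0 => /orP[/eqP//|].
by rewrite (gtn_eqF n0).
Qed.
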